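(* Consider algorithm C&CG-DRO applied to the two-stage DRO problem $w^*=\min_{\mathbf x\in\mathcal X}f_1(\mathbf x)+\sup_{P\in\mathcal P}E_P[Q(\mathbf x,\xi)]$. (i) If $\mathcal X$ is a finite set, the number of iterations is bounded by the cardinality $|\mathcal X|$. (ii) If the sample space $\Xi$ is finite, the number of iterations is bounded by the cardinality $|\Xi|$.
   Context: Setting. $\Xi\subseteq\mathbb R^{n_\xi}$ is closed and bounded, $\mathcal F$ a $\sigma$-algebra on $\Xi$ containing all singletons, $\mathcal M(\Xi,\mathcal F)$ the probability distributions on it. $\mathcal P=\{P\in\mathcal M(\Xi,\mathcal F):\int_\Xi P(d\xi)=1,\ \int_\Xi\psi_i(\xi)P(d\xi)\le\gamma_i\ \forall i\in[m]\}$ is nonempty, with $\psi_i$ real-valued, bounded and continuous. A finite family $(p_\xi)_{\xi\in S}$, $S\subseteq\Xi$ finite, is said to lie in $\mathcal P$ if $p_\xi\ge0$, $\sum_{\xi\in S}p_\xi=1$, $\sum_{\xi\in S}\psi_i(\xi)p_\xi\le\gamma_i$ for all $i$. The maximum of an infeasible maximization problem is $-\infty$. Recourse: $Q(\mathbf x,\xi)=\min\{f_2(\mathbf x,\xi,\mathbf y):\mathbf y\in\mathcal Y(\mathbf x,\xi)\}$, $\mathcal Y(\mathbf x,\xi)=\{\mathbf y:\mathbf g(\mathbf x,\xi,\mathbf y)\ge\mathbf 0\}$, $Q(\mathbf x,\xi)=+\infty$ if $\mathcal Y(\mathbf x,\xi)=\emptyset$; $Q>-\infty$ is assumed, and $Q(\mathbf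 x,\cdot)$ is upper semicontinuous. Let $\tilde{\mathcal Y}(\mathbf x,\xi)=\{(\mathbf y,\tilde{\mathbf y}):\mathbf g(\mathbf x,\xi,\mathbf y)+\tilde{\mathbf y}\ge\mathbf 0,\ \tilde{\mathbf y}\ge\mathbf 0\}$ and $\tilde Q_f(\mathbf x,\xi)=\min\{\|\tilde{\mathbf y}\|_1:(\mathbf y,\tilde{\mathbf y})\in\tilde{\mathcal Y}(\mathbf x,\xi)\}$. Subproblems for given $\mathbf x^*$: $\mathrm{WCEV}(F)$: $\eta^f(\mathbf x^* )=\max_{P\in\mathcal P}E_P[\tilde Q_f(\mathbf x^*,\xi)]$; $\mathrm{WCEV}(O)$: $\eta^o(\mathbf x^* )=\max_{P\in\mathcal P}E_P[Q(\mathbf x^*,\xi)]$. They are solved exactly by Oracle-1, i.e. by computing an optimal solution of the finite program $\max\{\sum_{j=1}^{m+1}h(\xi_j)p_j:\sum_jp_j=1,\ \sum_j\psi_i(\xi_j)p_j\le\gamma_i\ \forall i,\ \xi_j\in\Xi,\ p_j\ge0\}$ with $h=\tilde Q_f(\mathbf x^*,\cdot)$ or $h=Q(\mathbf x^*,\cdot)$; the resulting scenario sets are $\hat{\boldsymbol\xi}^f(\mathbf x^* )$ and $\hat{\boldsymbol\xi}^o(\mathbf x^* )$. Main master problem MMP for a finite set $\widehat{\boldsymbol\xi}=\widehat{\boldsymbol\xi}^f\cup\widehat{\boldsymbol\xi}^o\subseteq\Xi$: $\underline w=\min f_1(\mathbf x)+\eta$ over $\mathbf x\in\mathcal X$, $\eta$,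 and $(\mathbf y_\xi,\tilde{\mathbf y}_\xi)\in\tilde{\mathcal Y}(\mathbf x,\xi)$ $(\xi\in\widehat{\boldsymbol\xi})$, subject to $\eta\ge\max\{\sum_{\xi\in\widehat{\boldsymbol\xi}}f_2(\mathbf x,\xi,\mathbf y_\xi)p_\xi:(p_\xi)\in\mathcal P\}$ and $0\ge\max\{\sum_{\xi\in\widehat{\boldsymbol\xi}}\|\tilde{\mathbf y}_\xi\|_1p_\xi:(p_\xi)\in\mathcal P\}$. Algorithm C&CG-DRO with optimality tolerance $TOL$. Step 1: $LB=-\infty$, $UB=+\infty$, $t=1$, $\widehat{\boldsymbol\xi}^o=\widehat{\boldsymbol\xi}^f=\widehat{\boldsymbol\xi}=\emptyset$. Step 2: solve MMP; if infeasible, report that the two-stage DRO problem is infeasible and stop; if unbounded, select an arbitrary new feasible $\mathbf x^*$; otherwise get an optimal $\mathbf x^*$ and set $LB=\underline w$. Step 3: solve $\mathrm{WCEV}(F)$. Step 4: if $\eta^f(\mathbf x^* )=0$, solve $\mathrm{WCEV}(O)$ and set $\widehat{\boldsymbol\xi}^o:=\widehat{\boldsymbol\xi}^o\cup\hat{\boldsymbol\xi}^o(\mathbf x^* )$; if $\eta^f(\mathbf x^* )>0$, set $\widehat{\boldsymbol\xi}^f:=\widehat{\boldsymbol\xi}^f\cup\hat{\boldsymbol\xi}^f(\mathbf x^* )$ and $\eta^o(\mathbf x^* )=+\infty$; update $\widehat{\boldsymbol\xi}$ accordingly. Step 5: $UB=\min\{UB,f_1(\mathbf x^* )+\eta^o(\mathbf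 x^* )\}$. Step 6: if $UB-LB\le TOL$, return $\mathbf x^*$ and stop; otherwise $t:=t+1$ and go to Step 2. An iteration is one pass through Steps 2–6.
   Formalization: The number of iterations counts only passes that do not stop the algorithm (the final, terminating pass is excluded); in (ii) the main master problem is assumed not unbounded in the counted iterations after the first. Without these changes the bounds fail. *)

(* Defs.v *)
From mathcomp Require Import all_boot all_order all_algebra finmap.
From mathcomp Require Import all_classical all_reals all_analysis.

Set Implicit Arguments.
Unset Strict Implicit.
Unset Printing Implicit Defensive.

Import Order.TTheory GRing.Theory Num.Theory.
Import numFieldNormedType.Exports.

Local Open Scope classical_set_scope.
Local Open Scope ring_scope.

(* [F] is a family of subsets of [Xi] (the sigma-algebra on the sample space);
   [g x xi y] stacks the [ng] second-stage constraint functions. *)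
Record dro (R : realType) := Dro {
  nx : nat; nxi : nat; ny : nat; ng : nat; m : nat;
  X : set 'rV[R]_nx;
  Xi : set 'rV[R]_nxi;
  F : set (set 'rV[R]_nxi);
  psi : 'I_m -> 'rV[R]_nxi -> R;
  gamma : 'I_m -> R;
  f1 : 'rV[R]_nx -> R;
  f2 : 'rV[R]_nx -> 'rV[R]_nxi -> 'rV[R]_ny -> R;
  g : 'rV[R]_nx -> 'rV[R]_nxi -> 'rV[R]_ny -> 'rV[R]_ng }.

Arguments X {R} d _.
Arguments Xi {R} d _.
Arguments F {R} d _.
Arguments psi {R} d _ _.
Arguments gamma {R} d _.
Arguments f1 {R} d _.
Arguments f2 {R} d _ _ _.
Arguments g {R} d _ _ _.

Section problem.
Context {R : realType} (D : dro R).

Local Notation xvec := 'rV[R]_(nx D).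
Local Notation xivec := 'rV[R]_(nxi D).
Local Notation yvec := 'rV[R]_(ny D).
Local Notation gvec := 'rV[R]_(ng D).
Local Notation sample := (g_sigma_algebraType (F D)).

Definition Y (x : xvec) (xi : xivec) : set yvec :=
  [set y | forall k, 0 <= g D x xi y 0 k].

Definition Yt (x : xvec) (xi : xivec) : set (yvec * gvec) :=
  [set u | (forall k, 0 <= (g D x xi u.1 + u.2) 0 k) /\ forall k, 0 <= u.2 0 k].

Definition norm1 (v : gvec) : R := \sum_k `|v 0 k|.

(* The infimum of the empty set is +oo, the value of an infeasible recourse
   problem. *)
Definition Q (x : xvec) (xi : xivec) : \bar R :=
  ereal_inf [set (f2 D x xi y)%:E | y in Y x xi].

Definition Qf (x : xvec) (xi : xivec) : \bar R :=
  ereal_inf [set (norm1 u.2)%:E | u in Yt x xi].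

(* A probability on (Xi, F) is represented by its unique extension to the
   sigma-algebra that F generates on the whole space; this extension is
   concentrated on Xi. *)
Definition ambiguity : set (probability sample R) :=
  [set P : probability sample R | P (Xi D) = 1%E /\
    forall i, (\int[P]_(xi in (Xi D : set sample)) (psi D i xi)%:E
               <= (gamma D i)%:E)%E].

Definition wcev (h : xivec -> \bar R) : \bar R :=
  ereal_sup [set (\int[P]_(xi in (Xi D : set sample)) h xi)%E | P in ambiguity].

(* Only the values of [p] on [S] matter. *)
Definition ambiguity_on (S : {fset xivec}) : set (xivec -> R) :=
  [set p | [/\ forall xi, xi \in S -> 0 <= p xi,
               \sum_(xi <- S) p xi = 1 &
               forall i, \sum_(xi <- S) psi D i xi * p xi <= gamma D i]].

(* Feasible points of the finite program with m + 1 (possibly repeated)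
   scenarios. *)
Definition fin_feasible (xi : 'I_(m D).+1 -> xivec) (p : 'I_(m D).+1 -> R) :=
  [/\ forall j, Xi D (xi j), forall j, 0 <= p j, \sum_j p j = 1 &
      forall i, \sum_j psi D i (xi j) * p j <= gamma D i].

Definition fin_value (h : xivec -> \bar R)
    (xi : 'I_(m D).+1 -> xivec) (p : 'I_(m D).+1 -> R) : \bar R :=
  (\sum_j h (xi j) * (p j)%:E)%E.

(* [S] is a scenario set returned when max_P E_P[h] is solved exactly through
   an optimal solution (xi, p) of the finite program.  Scenarios of zero
   probability may or may not be kept in [S]. *)
Definition oracle1 (h : xivec -> \bar R) (S : {fset xivec}) : Prop :=
  exists xi p,
    [/\ fin_feasible xi p,
        forall xi' p', fin_feasible xi' p' ->
          (fin_value h xi' p' <= fin_value h xi p)%E,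
        wcev h = fin_value h xi p,
        forall j, 0 < p j -> xi j \in S &
        forall z, z \in S -> exists j, z = xi j].

(* The families (y_xi) and (yt_xi) are given by functions of which only the
   values on [S] matter; a supremum over the empty set is -oo. *)
Definition mmp_feasible (S : {fset xivec}) (x : xvec) (eta : R)
    (y : xivec -> yvec) (yt : xivec -> gvec) : Prop :=
  [/\ X D x,
      forall xi, xi \in S -> Yt x xi (y xi, yt xi),
      (ereal_sup [set (\sum_(xi <- S) f2 D x xi (y xi) * p xi)%:E
                 | p in ambiguity_on S] <= eta%:E)%E &
      (ereal_sup [set (\sum_(xi <- S) norm1 (yt xi) * p xi)%:E
                 | p in ambiguity_on S] <= 0)%E].

Definition mmp_unbounded (S : {fset xivec}) : Prop :=
  forall M : R, exists x eta y yt,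
    mmp_feasible S x eta y yt /\ f1 D x + eta < M.

Definition mmp_optimal (S : {fset xivec}) (x : xvec) (w : R) : Prop :=
  (exists eta y yt, mmp_feasible S x eta y yt /\ w = f1 D x + eta) /\
  (forall x' eta' y' yt', mmp_feasible S x' eta' y' yt' -> w <= f1 D x' + eta').

(* [used] records the first-stage decisions selected so far. *)
Record state := State {
  LB : \bar R; UB : \bar R;
  xiF : {fset xivec}; xiO : {fset xivec};
  used : seq xvec }.

Definition init : state := State -oo +oo fset0 fset0 [::].

Definition xihat (st : state) : {fset xivec} := (xiF st `|` xiO st)%fset.

(* Outcome of the master problem: the selected x and the new lower bound.
   There is none when the master problem is infeasible: the algorithm then
   stops. *)
Inductive master (st : state) : xvec -> \bar R -> Prop :=
| master_unbounded x eta y yt of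
    mmp_unbounded (xihat st) & mmp_feasible (xihat st) x eta y yt &
    x \notin used st : master st x (LB st)
| master_optimal x w of mmp_optimal (xihat st) x w : master st x w%:E.

(* One pass of the loop body, up to and excluding the stopping test. *)
Inductive pass (st : state) : state -> Prop :=
| pass_optimality x lb S of
    master st x lb & wcev (Qf x) = 0%E & oracle1 (Q x) S :
    pass st (State lb (Order.min (UB st) ((f1 D x)%:E + wcev (Q x))%E)
                   (xiF st) (xiO st `|` S)%fset (x :: used st))
| pass_feasibility x lb S of
    master st x lb & (0 < wcev (Qf x))%E & oracle1 (Qf x) S :
    pass st (State lb (Order.min (UB st) ((f1 D x)%:E + +oo)%E)
                   (xiF st `|` S)%fset (xiO st) (x :: used st)).

Definition stops (TOL : R) (st : state) : Prop :=
  (UB st - LB st <= TOL%:E)%E.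

(* [s t] is the state after [t] passes.  Each of the first [N] passes fails the
   stopping test and returns to the master problem, so [N] is the number of
   increments of the iteration counter; a pass that ends the algorithm is not
   counted. *)
Definition iterates (TOL : R) (s : nat -> state) (N : nat) : Prop :=
  s 0%N = init /\
  forall t, (t < N)%N -> pass (s t) (s t.+1) /\ ~ stops TOL (s t.+1).

End problem.

Arguments Q {R} D x xi.
Arguments Qf {R} D x xi.
Arguments ambiguity {R} D _.
Arguments mmp_unbounded {R} D S.

(* Main.v *)
Require Import Defs.
From mathcomp Require Import all_boot all_order all_algebra finmap.
From mathcomp Require Import all_classical all_reals all_analysis.

(** Each worst-case subproblem is solved by an optimal solution of the finite
program, so the worst-case expectation over the whole ambiguity set is the
expectation under a discrete distribution carried by the scenario set [S] that
the oracle returns.  A master problem whose scenarios include [S] sees that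
distribution in its own ambiguity set.  Hence, for a first-stage decision [x]
and the recourse values that the master problem pairs with it, the worst-case
infeasibility of [x] is [0] and the true worst-case cost of [x] is at most
[eta] ([oracle_Qf_le0], [oracle_Q_le]).

Call [x] settled in a state when the master problem contains scenarios solving
its subproblem and, if that was the optimality subproblem, [UB] accounts for
the cost of [x].  If a settled [x] is an optimal master solution of value [w],
then the feasibility subproblem cannot have been positive, so it was the
optimality subproblem that was solved, and [UB <= f1 x + wcev (Q x) <= w = LB]
([settled_optimal]): the stopping test succeeds.  This gives both bounds.

For finite [X], every selected decision is settled from then on, so selecting
one again as a master optimum ends the algorithm, while an unbounded master
problem only ever yields a new decision.  The selected decisions are therefore
pairwise distinct ([iterates_used]).

For finite [Xi], if a pass starting from a bounded master problem brought no
new scenario, the selected decision would be settled afterwards and still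
optimal for the unchanged master problem, so the pass would stop.  The first
pass starts from no scenario at all and brings at least one, since a
probability vector has an entry of positive mass.  So every pass enlarges the
scenario set, which stays inside [Xi] ([iterates_scenarios]). *)

Set Implicit Arguments.
Unset Strict Implicit.
Unset Printing Implicit Defensive.

Import Order.TTheory GRing.Theory Num.Theory.
Import numFieldNormedType.Exports.

Local Open Scope classical_set_scope.
Local Open Scope ring_scope.

(** The image law of the weights [p] under [xi].  The finite program may repeat
a scenario, whereas the master problem gives one weight to each scenario, so
the weights of equal scenarios have to be added up. *)
Definition image_law (R : realType) (T : eqType) (n : nat)
    (xi : 'I_n -> T) (p : 'I_n -> R) (z : T) : R :=
  \sum_(j | xi j == z) p j.

Lemma sum_image_law (R : realType) (T : choiceType) (n : nat)
    (xi : 'I_n -> T) (p : 'I_n -> R) (S : {fset T}) (c : T -> R) :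
  (forall j, p j != 0 -> xi j \in S) ->
  \sum_(z <- S) c z * image_law xi p z = \sum_j c (xi j) * p j.
Proof.
move=> pS.
under eq_bigr do rewrite /image_law big_distrr big_mkcond /=.
rewrite exchange_big /=; apply: eq_bigr => j _.
rewrite -big_mkcond /=.
have [->|/pS xiS] := eqVneq (p j) 0.
  by rewrite mulr0 big1 // => z _; rewrite mulr0.
under eq_bigl do rewrite eq_sym.
by rewrite -big_filter filter_pred1_uniq ?fset_uniq // big_seq1.
Qed.

Section problem.
Context {R : realType} (D : dro R).

Local Notation xvec := 'rV[R]_(nx D).
Local Notation xivec := 'rV[R]_(nxi D).
Local Notation yvec := 'rV[R]_(ny D).
Local Notation gvec := 'rV[R]_(ng D).

Lemma norm1_ge0 (v : gvec) : 0 <= norm1 v.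
Proof. by rewrite /norm1 sumr_ge0. Qed.

Lemma norm1_eq0 (v : gvec) : norm1 v = 0 -> v = 0.
Proof.
move=> v0; apply/rowP => k; rewrite mxE; apply/normr0_eq0.
by move: v0 => /psumr_eq0P ->.
Qed.

(** * Solutions of the finite program inside a master problem *)

Lemma fin_feasible_image_law (xi : 'I_(m D).+1 -> xivec) p (T : {fset xivec}) :
  fin_feasible xi p -> (forall j, p j != 0 -> xi j \in T) ->
  ambiguity_on T (image_law xi p).
Proof.
case=> _ p0 p1 ppsi pT; split=> [z _||i].
- by apply: sumr_ge0.
- rewrite -[RHS]p1.
  have := sum_image_law (fun=> 1) pT.
  by under eq_bigr do rewrite mul1r; under [RHS]eq_bigr do rewrite mul1r.
- by rewrite sum_image_law.
Qed.

(** The total mass [1] needs a scenario of positive mass, and the oracle keeps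
those. *)
Lemma oracle1_neq0 (h : xivec -> \bar R) (S : {fset xivec}) :
  oracle1 h S -> S != fset0.
Proof.
case=> xi [p [[_ p0 p1 _]] _ _ pS _]; apply/eqP => S0.
have : \sum_j p j = 0.
  apply: big1 => j _; apply/eqP; rewrite eq_le p0 andbT leNgt.
  by apply/negP => /pS; rewrite S0 inE.
by rewrite p1 => /eqP; rewrite oner_eq0.
Qed.

Section oracle_in_master.
Variables (S T : {fset xivec}) (x : xvec) (eta : R).
Variables (y : xivec -> yvec) (yt : xivec -> gvec).
Hypotheses (ST : (S `<=` T)%fset) (feas : mmp_feasible T x eta y yt).

Lemma master_slack_le0 (xi : 'I_(m D).+1 -> xivec) p :
  fin_feasible xi p -> (forall j, p j != 0 -> xi j \in T) ->
  \sum_j norm1 (yt (xi j)) * p j <= 0.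
Proof.
move=> fp pT; case: feas => _ _ _ slack.
rewrite -(sum_image_law (fun z => norm1 (yt z)) pT) -lee_fin; apply: le_trans slack.
by apply: ereal_sup_ubound; exists (image_law xi p) => //;
  exact: fin_feasible_image_law.
Qed.

(** The slack of the master solution is a candidate in the minimum defining
[Qf], so [Qf] is dominated scenariowise by a cost of nonpositive expectation. *)
Lemma oracle_Qf_le0 : oracle1 (Qf D x) S -> (wcev (Qf D x) <= 0)%E.
Proof.
case=> xi [p [fp _ -> pS _]].
have p0 j : 0 <= p j by case: fp.
have pT j : p j != 0 -> xi j \in T.
  by move=> pj; apply: (fsubsetP ST); apply: pS; rewrite lt_def pj p0.
have : ((\sum_j norm1 (yt (xi j)) * p j)%:E <= 0%:E)%E.
  by rewrite lee_fin master_slack_le0.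
apply: le_trans; rewrite /fin_value -sumEFin; apply: lee_sum => j _.
have [->|pj] := eqVneq (p j) 0; first by rewrite mulr0 mule0.
rewrite EFinM; apply: lee_wpmul2r; first by rewrite lee_fin.
apply: ereal_inf_lbound; exists (y (xi j), yt (xi j)) => //.
by case: feas => _ feasY _ _; apply/feasY/pT.
Qed.

(** Since the expected slack vanishes, the slack itself vanishes on every
scenario of positive mass; there the master recourse is a genuine recourse, and
[Q] is at most its cost. *)
Lemma oracle_Q_le : oracle1 (Q D x) S -> (wcev (Q D x) <= eta%:E)%E.
Proof.
case=> xi [p [fp _ -> pS _]].
have p0 j : 0 <= p j by case: fp.
have pT j : p j != 0 -> xi j \in T.
  by move=> pj; apply: (fsubsetP ST); apply: pS; rewrite lt_def pj p0.
have slack_ge0 j : true -> 0 <= norm1 (yt (xi j)) * p j.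
  by move=> _; rewrite mulr_ge0 ?norm1_ge0.
have slack0 : \sum_j norm1 (yt (xi j)) * p j = 0.
  by apply/eqP; rewrite eq_le master_slack_le0 // sumr_ge0.
have yt0 j : p j != 0 -> yt (xi j) = 0.
  move=> pj; apply: norm1_eq0; apply/eqP.
  have := psumr_eq0P slack_ge0 slack0 (isT : xpredT j).
  by move/eqP; rewrite mulf_eq0 (negbTE pj) orbF.
case: feas => _ feasY cost _.
apply: le_trans cost.
apply: (@le_trans _ _ (\sum_j f2 D x (xi j) (y (xi j)) * p j)%:E); last first.
  rewrite -(sum_image_law (fun z => f2 D x z (y z)) pT).
  by apply: ereal_sup_ubound; exists (image_law xi p) => //;
    exact: fin_feasible_image_law.
rewrite /fin_value -sumEFin; apply: lee_sum => j _.
have [->|pj] := eqVneq (p j) 0; first by rewrite mulr0 mule0.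
rewrite EFinM; apply: lee_wpmul2r; first by rewrite lee_fin.
apply: ereal_inf_lbound; exists (y (xi j)) => // k.
by case: (feasY _ (pT _ pj)) => /(_ k); rewrite /= yt0 // addr0.
Qed.

End oracle_in_master.

(** * Settled decisions *)

(** The second alternative records the bound on [UB] and not just the scenarios:
both persist when the algorithm goes on ([settled_mono]), so a decision settled
once can be confronted with the optimum of any later master problem. *)
Definition settled (st : state D) (x : xvec) : Prop :=
  exists2 S : {fset xivec}, (S `<=` xihat st)%fset &
    (oracle1 (Qf D x) S /\ (0 < wcev (Qf D x))%E) \/
    (oracle1 (Q D x) S /\ (UB st <= (f1 D x)%:E + wcev (Q D x))%E).

(** The master problem already charges [x] its true worst-case cost, so its
value [w] is an upper bound as much as a lower bound. *)
Lemma settled_optimal (st : state D) x w :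
  settled st x -> mmp_optimal (xihat st) x w -> (UB st <= w%:E)%E.
Proof.
move=> [S ST cut] [[eta [y [yt [feas ->]]]] _].
case: cut => [[oS wpos]|[oS ub]].
  by have := oracle_Qf_le0 ST feas oS; rewrite leNgt wpos.
by apply: (le_trans ub); rewrite EFinD leeD2l // (oracle_Q_le ST feas oS).
Qed.

Lemma settled_mono (st st' : state D) x :
  (xihat st `<=` xihat st')%fset -> (UB st' <= UB st)%E ->
  settled st x -> settled st' x.
Proof.
move=> sub ub [S ST cut]; exists S; first exact: fsubset_trans sub.
by case: cut => [|[oS ub']]; [left|right; split=> //; exact: le_trans ub'].
Qed.

Lemma settled_xihat_neq0 (st : state D) x : settled st x -> xihat st != fset0.
Proof.
case=> S ST cut; have /negP S0 : S != fset0.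
  by case: cut => -[/oracle1_neq0].
by apply/negP => /eqP st0; apply: S0; rewrite -fsubset0 -st0.
Qed.

Lemma master_X (st : state D) x lb : master st x lb -> X D x.
Proof. by case=> [x' eta y yt _ []|x' w [[eta [y [yt [[]]]]]]]. Qed.

Lemma masterP (st : state D) x lb : master st x lb ->
  (mmp_unbounded D (xihat st) /\ x \notin used st) \/
  exists2 w, lb = w%:E & mmp_optimal (xihat st) x w.
Proof.
by case=> [x' eta y yt unb _ new|x' w opt]; [left|right; exists w].
Qed.

Lemma oracle1_Xi (h : xivec -> \bar R) (S : {fset xivec}) z :
  oracle1 h S -> z \in S -> Xi D z.
Proof. by case=> xi [p [[xiXi _ _ _] _ _ _ Sxi]] /Sxi[j ->]. Qed.

Lemma passP (st st' : state D) : pass st st' ->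
  exists x,
    [/\ master st x (LB st') /\ used st' = x :: used st,
        (xihat st `<=` xihat st')%fset, (UB st' <= UB st)%E, settled st' x &
        forall z, z \in xihat st' -> z \notin xihat st -> Xi D z].
Proof.
case=> x lb S ms wf oS; exists x; split=> //=.
- by rewrite /xihat /= fsetUA fsubsetUl.
- by rewrite ge_min lexx.
- exists S; first by rewrite /xihat /= fsetUA fsubsetUr.
  by right; split=> //=; rewrite ge_min lexx orbT.
- move=> z; rewrite /xihat /= fsetUA in_fsetU.
  by case/orP => [->//|zS _]; exact: oracle1_Xi oS zS.
- by rewrite /xihat /= fsetUAC fsubsetUl.
- by rewrite ge_min lexx.
- exists S; last by left.
  by rewrite /xihat /= fsetUAC fsubsetUr.
- move=> z; rewrite /xihat /= fsetUAC in_fsetU.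
  by case/orP => [->//|zS _]; exact: oracle1_Xi oS zS.
Qed.

Lemma stops_le (TOL : R) (st : state D) w : 0 <= TOL ->
  LB st = w%:E -> (UB st <= w%:E)%E -> stops TOL st.
Proof.
move=> TOL0 lbw ubw; rewrite /stops lbw leeBlDr //.
by apply: (le_trans ubw); rewrite leeDr // lee_fin.
Qed.

(** * Counting iterations *)

Section counting.
Variables (TOL : R) (s : nat -> state D) (N : nat).
Hypotheses (TOL_ge0 : 0 <= TOL) (its : iterates TOL s N).

(** A decision selected twice would be settled at its second selection; there
it cannot come from an unbounded master problem, which yields new decisions,
and as a master optimum it would have made the pass stop. *)
Lemma iterates_used t : (t <= N)%N ->
  [/\ uniq (used (s t)), size (used (s t)) = t &
      forall x, x \in used (s t) -> X D x /\ settled (s t) x].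
Proof.
have [s0 step] := its.
elim: t => [|t IH] tN; first by rewrite s0; split.
have [uq sz ok] := IH (ltnW tN).
have [ps nst] := step _ tN.
have [x [[ms us] sub ub sx _]] := passP ps.
rewrite us; split=> [||z] /=.
- rewrite uq andbT; apply/negP => xu.
  case: (masterP ms) => [[_ /negP]|[w lbw opt]]; first exact.
  apply: nst; apply: (stops_le TOL_ge0 lbw); apply: (le_trans ub).
  by apply: settled_optimal opt; have [] := ok _ xu.
- by rewrite sz.
- rewrite inE => /orP[/eqP ->|zu]; first by split; [exact: master_X ms|].
  by have [Xz /(settled_mono sub ub)] := ok _ zu.
Qed.

(** A pass that adds no scenario leaves the master problem unchanged, so the
decision that it settles is also an optimum for the new state, and it stops.
The count starts at [0] because the initial
master problem has no scenario; it may be unbounded, which is why the first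
pass is treated through [settled_xihat_neq0]. *)
Lemma iterates_scenarios t : (t <= N)%N ->
  (forall t, (0 < t < N)%N -> ~ mmp_unbounded D (xihat (s t))) ->
  (t <= #|` xihat (s t)|)%N /\ forall z, z \in xihat (s t) -> Xi D z.
Proof.
have [s0 step] := its.
move=> + bdd; elim: t => [|t IH] tN.
  by rewrite s0; split=> // z; rewrite /xihat /= fsetU0 inE.
have [card_t inXi] := IH (ltnW tN).
have [ps nst] := step _ tN.
have [x [[ms _] sub ub sx new]] := passP ps.
split; last first.
  move=> z zs'; have [zs|zs] := boolP (z \in xihat (s t)); first exact: inXi.
  exact: new.
case: (posnP t) => t0.
  by rewrite {1}t0 cardfs_gt0 (settled_xihat_neq0 sx).
apply: (leq_ltn_trans card_t); apply: fproper_ltn_card.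
rewrite fproperEneq sub andbT; apply/eqP => same.
case: (masterP ms) => [[unb _]|[w lbw]].
  by apply: (bdd t) unb; rewrite t0.
rewrite same => opt; apply: nst; apply: (stops_le TOL_ge0 lbw).
exact: settled_optimal sx opt.
Qed.

End counting.

End problem.

Theorem proposition17 (R : realType) (D : dro R) (TOL : R)
  (Xi_closed : closed (Xi D))
  (Xi_bounded : bounded_set (Xi D))
  (F_sigma : sigma_algebra (Xi D) (F D))
  (F_sub : forall A, F D A -> A `<=` Xi D)
  (F_single : forall xi, Xi D xi -> F D [set xi])
  (P_nonempty : ambiguity D !=set0)
  (psi_bounded : forall i, [bounded psi D i xi | xi in Xi D])
  (psi_continuous : forall i, {within Xi D, continuous (psi D i)})
  (Q_gtNy : forall x xi, X D x -> Xi D xi -> (-oo < Q D x xi)%E)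
  (Q_usc : forall x, X D x ->
     lower_semicontinuous (fun xi : subspace (Xi D) => - Q D x xi)%E)
  (TOL_ge0 : 0 <= TOL) :
  (finite_set (X D) ->
     forall (s : nat -> state D) (N : nat), iterates TOL s N ->
       (N <= #|` fset_set (X D)|)%N)
  /\
  (finite_set (Xi D) ->
     forall (s : nat -> state D) (N : nat), iterates TOL s N ->
       (forall t, (0 < t < N)%N -> ~ mmp_unbounded D (xihat (s t))) ->
       (N <= #|` fset_set (Xi D)|)%N).
Proof.
split=> [finX s N its|finXi s N its bdd].
- have [uq sz used_X] := iterates_used TOL_ge0 its (leqnn N).
  rewrite -{1}sz; apply: uniq_leq_size uq _ => x /used_X[Xx _].
  by rewrite in_fset_set // inE.
- have [card_N inXi] := iterates_scenarios TOL_ge0 its (leqnn N) bdd.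
  apply: (leq_trans card_N); apply: fsubset_leq_card.
  by apply/fsubsetP => z /inXi Xiz; rewrite in_fset_set // inE.
Qed.
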